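(* Fix $t\in\mathbb{N}$. A matroid $M$ is transversal if and only if $M^t$ is transversal. Furthermore, $M$ is fundamental transversal if and only if $M^t$ is fundamental transversal.
   Context: A cyclic flat of a matroid $M$ is a flat $F$ such that $M|F$ has no coloops; $\mathcal{Z}(M)$ denotes the set of cyclic flats, and a matroid is determined by its cyclic flats and their ranks. The $t$-expansion: for each $e\in E(M)$ let $S_e$ be a $t$-element set with $e\in S_e$, the sets $S_e$ pairwise disjoint; for $X\subseteq E(M)$ let $S_X=\bigcup_{e\in X}S_e$. The $t$-expansion $M^t$ is the matroid on $S_{E(M)}$ whose cyclic flats are exactly the sets $S_A$ with $A\in\mathcal{Z}(M)$, with $r_{M^t}(S_A)=t\cdot r_M(A)$. A matroid is transversal if its independent sets are the partial transversals of some finite family of subsets of its ground set (equivalently, it is a matroid union of rank-$1$ matroids). A matroid is fundamental (principal) transversal if it is transversal and has a basis $B$ such that $r(F)=|F\cap B|$ for every cyclic flat $F$. *)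

(* Defs.v *)
From mathcomp Require Import all_boot.

Set Implicit Arguments.
Unset Strict Implicit.
Unset Printing Implicit Defensive.

(* The ground set is a subset of the carrier type, so that a restriction of a *)
(* matroid is a matroid over the same carrier.                                *)
Record matroid (T : finType) := Matroid {
  ground : {set T};
  indep : pred {set T};
  indep_ground : forall I, indep I -> I \subset ground;
  indep0 : indep set0;
  indepS : forall I J : {set T}, I \subset J -> indep J -> indep I;
  indep_aug : forall I J : {set T}, indep I -> indep J -> #|I| < #|J| ->
    exists2 e, e \in J :\: I & indep (e |: I)
}.

Section Matroid.
Variable T : finType.
Implicit Types (M : matroid T) (X F I B : {set T}).

Definition rank M X : nat :=
  \max_(I : {set T} | indep M I && (I \subset X)) #|I|.

Definition basis M B : bool := maxset (indep M) B.

Definition coloop M (e : T) : bool :=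
  (e \in ground M) && [forall B : {set T}, basis M B ==> (e \in B)].

Definition flat M F : bool :=
  (F \subset ground M) &&
  [forall e in ground M :\: F, rank M F < rank M (e |: F)].

Section Restriction.
Variables (M : matroid T) (X : {set T}).

Let rindep I := indep M I && (I \subset X).

Lemma restrict_ground I : rindep I -> I \subset ground M :&: X.
Proof. by case/andP=> /indep_ground sIG sIX; rewrite subsetI sIG. Qed.

Lemma restrict0 : rindep set0.
Proof. by rewrite /rindep indep0 sub0set. Qed.

Lemma restrictS (I J : {set T}) : I \subset J -> rindep J -> rindep I.
Proof.
move=> sIJ /andP[/(indepS sIJ) iI sJX].
by rewrite /rindep iI (subset_trans sIJ).
Qed.

Lemma restrict_aug (I J : {set T}) : rindep I -> rindep J -> #|I| < #|J| ->
  exists2 e, e \in J :\: I & rindep (e |: I).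
Proof.
move=> /andP[iI sIX] /andP[iJ sJX] /(indep_aug iI iJ)[e eJI ieI].
exists e => //; rewrite /rindep ieI subUset sub1set sIX andbT /=.
by case/setDP: eJI => /(subsetP sJX).
Qed.

Definition restrict : matroid T :=
  Matroid restrict_ground restrict0 restrictS restrict_aug.

End Restriction.

Definition cyclic_flat M F : bool :=
  flat M F && [forall e, ~~ coloop (restrict M F) e].

(* An injection X -> 'I_n picking a member of the family for each element of  *)
(* X; its domain is the subtype X so that the empty set is a partial          *)
(* transversal of the empty family as well.                                   *)
Definition partial_transversal n (A : 'I_n -> {set T}) X : Prop :=
  exists2 f : {x : T | x \in X} -> 'I_n,
    injective f & forall x, val x \in A (f x).

Definition transversal_matroid M : Prop :=
  exists n (A : 'I_n -> {set T}),
    (forall j, A j \subset ground M) /\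
    (forall X, indep M X <-> partial_transversal A X).

Definition fundamental_transversal_matroid M : Prop :=
  transversal_matroid M /\
  exists2 B, basis M B & forall F, cyclic_flat M F -> rank M F = #|F :&: B|.

End Matroid.

Definition block_union (T U : finType) (S : T -> {set U}) (X : {set T}) :
  {set U} := \bigcup_(e in X) S e.

(* [i] identifies the elements of M with elements of the carrier of the       *)
(* expansion, and [i e \in S e] stands for e \in S_e; when U is T and i is    *)
(* the identity this is literal.                                              *)
Record expansion_blocks (T U : finType) (t : nat) (M : matroid T)
    (i : T -> U) (S : T -> {set U}) : Prop := ExpansionBlocks {
  block_mem : forall e, e \in ground M -> i e \in S e;
  block_card : forall e, e \in ground M -> #|S e| = t;
  block_disj : forall e f, e \in ground M -> f \in ground M -> e != f ->
    [disjoint S e & S f]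
}.

Record is_expansion (T U : finType) (t : nat) (M : matroid T)
    (i : T -> U) (S : T -> {set U}) (N : matroid U) : Prop := IsExpansion {
  expansion_blocksP : expansion_blocks t M i S;
  expansion_ground : ground N = block_union S (ground M);
  expansion_cyclic_flat : forall F : {set U},
    cyclic_flat N F <-> exists2 A, cyclic_flat M A & F = block_union S A;
  expansion_rank : forall A, cyclic_flat M A ->
    rank N (block_union S A) = t * rank M A
}.

Section RankTheory.
Variables (T : finType) (M : matroid T).
Implicit Types X Y I : {set T}.

Lemma rank_ge X I : indep M I -> I \subset X -> #|I| <= rank M X.
Proof.
move=> iI sIX; rewrite /rank.
have := @leq_bigmax_cond _ (fun J => indep M J && (J \subset X)) (fun J => #|J|).
by apply; rewrite iI.
Qed.

Lemma rank_le X k :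
  (forall I, indep M I -> I \subset X -> #|I| <= k) -> rank M X <= k.
Proof. by move=> h; apply/bigmax_leqP => I /andP[]; apply: h. Qed.

Lemma rank_witness X : exists I, [/\ indep M I, I \subset X & #|I| = rank M X].
Proof.
rewrite /rank (bigmax_eq_arg set0) ?indep0 ?sub0set //.
case: arg_maxnP => [|I /andP[iI sIX] _]; first by rewrite indep0 sub0set.
by exists I.
Qed.

Lemma rankS X Y : X \subset Y -> rank M X <= rank M Y.
Proof.
move=> sXY; apply: rank_le => I iI sIX.
by rewrite rank_ge // (subset_trans sIX).
Qed.

Lemma rank_indep I : indep M I -> rank M I = #|I|.
Proof.
move=> iI; apply/eqP; rewrite eqn_leq (rank_ge iI) // andbT.
by apply: rank_le => J _ /subset_leq_card.
Qed.

Lemma rank_extend X I : indep M I -> I \subset X ->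
  exists J, [/\ indep M J, I \subset J, J \subset X & #|J| = rank M X].
Proof.
move=> iI sIX; have := rank_ge iI sIX.
move: {2}(rank M X - #|I|) (leqnn (rank M X - #|I|)) => n.
elim: n I iI sIX => [|n IHn] I iI sIX.
  rewrite leqn0 subn_eq0 => le1 le2; exists I; split=> //.
  by apply/eqP; rewrite eqn_leq le1 le2.
move=> le_n le_I; have [ge_I|lt_I] := leqP (rank M X) #|I|.
  by exists I; split=> //; apply/eqP; rewrite eqn_leq ge_I le_I.
have [K [iK sKX cK]] := rank_witness X.
have [|e /setDP[eK eI] ieI] := indep_aug iI iK; first by rewrite cK.
have seX : e |: I \subset X by rewrite subUset sub1set (subsetP sKX).
have ceI : #|e |: I| = #|I|.+1 by rewrite cardsU1 eI.
have [] // := IHn _ ieI seX; first by rewrite ceI subnS -ltnS prednK ?subn_gt0.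
  by rewrite rank_ge.
by move=> J [iJ sJ sJX cJ]; exists J; split=> //; apply: subset_trans sJ; rewrite subsetUr.
Qed.

Lemma rank_submod X Y :
  rank M (X :|: Y) + rank M (X :&: Y) <= rank M X + rank M Y.
Proof.
have [I [iI sI cI]] := rank_witness (X :&: Y).
have sIU : I \subset X :|: Y.
  by apply: subset_trans sI _; rewrite subIset // subsetUl.
have [J [iJ sIJ sJ cJ]] := rank_extend iI sIU.
have h Z : #|J :&: Z| <= rank M Z.
  by rewrite rank_ge ?subsetIr // (indepS _ iJ) // subsetIl.
apply: leq_trans (leq_add (h X) (h Y)); rewrite -cardsUI -cJ -cI.
apply: leq_add; apply: subset_leq_card.
  by rewrite -setIUr subsetI subxx.
by rewrite setIACA setIid subsetI sIJ.
Qed.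

Lemma rank0 : rank M set0 = 0.
Proof. by rewrite rank_indep ?cards0 ?indep0. Qed.

Lemma basis_restrictP X I :
  reflect [/\ indep M I, I \subset X & #|I| = rank M X]
          (basis (restrict M X) I).
Proof.
apply: (iffP maxsetP) => [[/andP[iI sIX] mI]|[iI sIX cI]].
  split=> //; have [J [iJ sIJ sJX cJ]] := rank_extend iI sIX.
  by rewrite -cJ (mI J) //= iJ sJX.
split=> [|J /andP[iJ sJX] sIJ]; first by rewrite /= iI.
apply/esym/eqP; rewrite eqEcard sIJ cI; exact: rank_ge.
Qed.

End RankTheory.

Section ExpansionExistence.
Variables (T U : finType) (t : nat) (M : matroid T).
Variables (i : T -> U) (S : T -> {set U}).
Hypothesis blk : expansion_blocks t M i S.

Local Notation E := (ground M).
Local Notation "'S_ X" := (block_union S X) (at level 8, X at level 2).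
Local Notation r := (rank M).

Lemma mem_blockP (X : {set T}) y : reflect (exists2 e, e \in X & y \in S e) (y \in 'S_ X).
Proof. exact: (iffP bigcupP). Qed.

Lemma mem_block (X : {set T}) e y :
  X \subset E -> e \in E -> y \in S e -> (y \in 'S_ X) = (e \in X).
Proof.
move=> sX eE ye; apply/mem_blockP/idP => [[f fX yf]|eX]; last by exists e.
have [-> //|ne] := eqVneq e f.
by have /disjointFr/(_ ye) := block_disj blk eE (subsetP sX _ fX) ne; rewrite yf.
Qed.

Lemma block_unionI (X Y : {set T}) : X \subset E -> Y \subset E -> 'S_(X :&: Y) = 'S_ X :&: 'S_ Y.
Proof.
move=> sX sY; apply/setP=> y; rewrite inE; apply/idP/andP.
  by case/mem_blockP=> e /setIP[eX eY] ye; split; apply/mem_blockP; exists e.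
case=> /mem_blockP[e eX ye]; rewrite (mem_block sY (subsetP sX _ eX) ye) => eY.
by apply/mem_blockP; exists e; rewrite ?inE ?eX.
Qed.

Lemma block_unionU (X Y : {set T}) : 'S_(X :|: Y) = 'S_ X :|: 'S_ Y.
Proof. exact: bigcup_setU. Qed.

Lemma block_unionS (X Y : {set T}) : X \subset Y -> 'S_ X \subset 'S_ Y.
Proof.
by move=> sXY; apply/subsetP=> y /mem_blockP[e /(subsetP sXY) eY ye]; apply/mem_blockP; exists e.
Qed.

Lemma card_block_union (X : {set T}) : X \subset E -> #|'S_ X| = t * #|X|.
Proof.
move: {2}#|X| (erefl #|X|) => n; elim: n X => [|n IHn] X cX sX.
  by rewrite cX (cards0_eq cX) /block_union big_set0 cards0 muln0.
have /card_gt0P[e eX] : 0 < #|X| by rewrite cX.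
have eE := subsetP sX _ eX.
have sX' : X :\ e \subset E by apply: subset_trans sX; rewrite subsetDl.
have cX' : #|X :\ e| = n by have := cardsD1 e X; rewrite eX cX => -[].
rewrite -{1}(setD1K eX) block_unionU cardsU (IHn _ cX' sX') cX' cX.
rewrite -block_unionI ?sub1set // [_ :&: _](_ : _ = set0); last first.
  by apply/setP=> f; rewrite !inE; case: eqP.
by rewrite /block_union big_set0 cards0 subn0 big_set1 (block_card blk eE) mulnS.
Qed.

(* The matroid induced by the integer polymatroid t * rank, each element      *)
(* being replaced by t elements placed freely on it.                          *)
Let xindep (X : {set U}) : bool :=
  (X \subset 'S_ E) &&
  [forall A : {set T}, (A \subset E) ==> (#|X :&: 'S_ A| <= t * r A)].

Lemma xindepP (X : {set U}) :
  reflect (X \subset 'S_ E /\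
           forall A : {set T}, A \subset E -> #|X :&: 'S_ A| <= t * r A)
          (xindep X).
Proof.
apply: (iffP andP) => -[sX h]; split=> //; first by move=> A; apply/implyP/(forallP h).
by apply/forallP=> A; apply/implyP/h.
Qed.

Lemma xindep_ground X : xindep X -> X \subset 'S_ E.
Proof. by case/andP. Qed.

Lemma xindep0 : xindep set0.
Proof. by apply/xindepP; split=> [|A _]; rewrite ?sub0set // set0I cards0. Qed.

Lemma xindepS (I J : {set U}) : I \subset J -> xindep J -> xindep I.
Proof.
move=> sIJ /xindepP[sJ h]; apply/xindepP; split; first exact: subset_trans sJ.
by move=> A /h; apply: leq_trans; apply/subset_leq_card/setSI.
Qed.

Let tight (I : {set U}) (A : {set T}) : bool :=
  (A \subset E) && (t * r A <= #|I :&: 'S_ A|).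

Lemma tight_witness (I : {set U}) y : xindep I -> y \in 'S_ E -> ~~ xindep (y |: I) ->
  exists2 A, tight I A & y \in 'S_ A.
Proof.
case/xindepP=> sI h yE; rewrite /xindep subUset sub1set yE sI /=.
case/forallPn=> A; rewrite negb_imply -ltnNge => /andP[sA lt_A].
have [yA|yA] := boolP (y \in 'S_ A); last first.
  move: lt_A; rewrite ltnNge (leq_trans _ (h A sA)) //; apply/subset_leq_card.
  apply/subsetP=> z /setIP[/setU1P[->|zI] zA]; first by rewrite zA in yA.
  by rewrite inE zI.
exists A => //; rewrite /tight sA /= -ltnS (leq_trans lt_A) //.
by rewrite setIUl (leq_trans (leq_card_setU _ _)) // -add1n leq_add2r -(cards1 y) subset_leq_card ?subsetIl.
Qed.

Lemma tightU (I : {set U}) (A B : {set T}) :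
  xindep I -> tight I A -> tight I B -> tight I (A :|: B).
Proof.
case/xindepP=> _ h /andP[sA tA] /andP[sB tB]; rewrite /tight subUset sA sB /=.
have sAB : A :&: B \subset E by rewrite subIset // sA.
rewrite -(leq_add2r (t * r (A :&: B))) -mulnDr.
apply: leq_trans (_ : t * (r A + r B) <= _); first by rewrite leq_mul2l rank_submod orbT.
rewrite mulnDr (leq_trans (leq_add tA tB)) // -cardsUI -setIUr -block_unionU.
by rewrite leq_add2l setIACA setIid -block_unionI // h.
Qed.

Lemma tight0 (I : {set U}) : tight I set0.
Proof. by rewrite /tight sub0set rank0 muln0. Qed.

Lemma xindep_aug (I J : {set U}) : xindep I -> xindep J -> #|I| < #|J| ->
  exists2 e, e \in J :\: I & xindep (e |: I).
Proof.
move=> iI iJ lt_IJ; apply/exists_inP; apply: contraLR lt_IJ => /exists_inPn dep.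
rewrite -leqNgt; pose A := \bigcup_(B | tight I B) B.
have tA : tight I A.
  by apply: (big_ind (tight I)) => //; [apply: tight0 | move=> ? ?; apply: tightU].
have sJA : J :\: I \subset 'S_ A.
  apply/subsetP=> y yJI; have yE : y \in 'S_ E.
    by case/setDP: yJI => /(subsetP (xindep_ground iJ)).
  have [B tB] := tight_witness iI yE (dep _ yJI).
  by apply/subsetP/block_unionS/bigcup_sup.
case/andP: tA => sA tA; case/xindepP: iJ => _ /(_ A sA) hJ.
rewrite -(cardsID 'S_ A J) -(cardsID 'S_ A I) leq_add ?(leq_trans hJ) //.
apply/subset_leq_card/subsetP => y /setDP[yJ yA]; rewrite inE yA /=.
by apply: contraR yA => yI; apply: (subsetP sJA); rewrite inE yI.
Qed.

Definition free_expansion : matroid U :=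
  Matroid xindep_ground xindep0 xindepS xindep_aug.

Local Notation N := free_expansion.

Lemma block_indep (I : {set T}) : indep M I -> indep N ('S_ I).
Proof.
move=> iI; have sI := indep_ground iI; apply/xindepP; split=> [|A sA].
  exact: block_unionS.
have sIA : I :&: A \subset E by rewrite subIset // sI.
rewrite -block_unionI // card_block_union // leq_mul2l rank_ge ?subsetIr ?orbT //.
by apply: indepS iI; rewrite subsetIl.
Qed.

Lemma rank_block (A : {set T}) : A \subset E -> rank N ('S_ A) = t * r A.
Proof.
move=> sA; apply/eqP; rewrite eqn_leq; apply/andP; split.
  by apply: rank_le => I /xindepP[_ /(_ A sA)] h /setIidPl <-.
have [I [iI sIA <-]] := rank_witness M A.
rewrite -card_block_union ?(indep_ground iI) //.
by rewrite rank_ge ?block_indep ?block_unionS.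
Qed.

Lemma mem_blockE y : y \in 'S_ E -> exists2 e, e \in E & y \in S e.
Proof. by move/mem_blockP. Qed.

Lemma t_gt0 e : e \in E -> 0 < t.
Proof.
move=> eE; rewrite -(block_card blk eE); apply/card_gt0P.
by exists (i e); apply: (block_mem blk).
Qed.

Lemma cyclic_flat_block (A : {set T}) : cyclic_flat M A -> cyclic_flat N ('S_ A).
Proof.
case/andP=> /andP[sA fA] cA; apply/andP; split.
  rewrite /flat block_unionS //=; apply/forall_inP=> y /setDP[/mem_blockE[e eE ye] yA].
  have eA : e \notin A by rewrite -(mem_block sA eE ye).
  have /(forall_inP fA) : e \in E :\: A by rewrite inE eA.
  have [I [iI sIA cI]] := rank_witness M A.
  have [K [iK sKA cK]] := rank_witness M (e |: A); rewrite -cI -cK => lt_IK.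
  have [f /setDP[fK fI] ifI] := indep_aug iI iK lt_IK.
  have fE : f = e.
    apply/eqP; apply: contraTT (ltnSn #|I|) => ne; rewrite -leqNgt.
    have <- : #|f |: I| = #|I|.+1 by rewrite cardsU1 fI.
    rewrite cI rank_ge // subUset sIA sub1set andbT.
    by have := subsetP sKA _ fK; rewrite !inE (negPf ne).
  rewrite {f fK}fE in fI ifI; rewrite rank_block // -cI -card_block_union ?(indep_ground iI) //.
  have yI : y \notin 'S_ I by rewrite (mem_block (indep_ground iI) eE ye).
  have <- : #|y |: 'S_ I| = #|'S_ I|.+1 by rewrite cardsU1 yI.
  rewrite rank_ge //; last by rewrite setUS ?block_unionS.
  apply: indepS (block_indep ifI); rewrite block_unionU setSU // sub1set.
  by rewrite /block_union big_set1.
apply/forallP=> y; apply/negP=> /andP[/setIP[yE yA] /forallP yB].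
have [e eA ye] := mem_blockP _ _ yA; have eE := subsetP sA _ eA.
have := forallP cA e; rewrite negb_and inE eE eA /= => /forallPn[I].
rewrite negb_imply => /andP[/basis_restrictP[iI sIA cI] eI].
suff /(implyP (yB _)) : basis (restrict N 'S_ A) 'S_ I.
  by rewrite (mem_block (indep_ground iI) eE ye) (negPf eI).
apply/basis_restrictP; split; [exact: block_indep|exact: block_unionS|].
by rewrite rank_block // card_block_union ?(indep_ground iI) // cI.
Qed.

Lemma block_cyclic_flat (F : {set U}) : cyclic_flat N F ->
  exists2 A, cyclic_flat M A & F = 'S_ A.
Proof.
case/andP=> /andP[sF fF] cF.
have avoid y : y \in F -> exists I, [/\ indep N I, I \subset F, #|I| = rank N F & y \notin I].
  move=> yF; have := forallP cF y; rewrite negb_and inE yF (subsetP sF) //=.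
  case/forallPn=> I; rewrite negb_imply => /andP[/basis_restrictP[? ? ?] ?].
  by exists I.
have full e y : e \in E -> y \in S e -> y \in F -> S e \subset F.
  move=> eE ye yF; have [I [iI sIF cI yI]] := avoid y yF.
  have dy : ~~ xindep (y |: I).
    apply/negP=> iyI; have := @rank_ge _ N F _ iyI.
    by rewrite subUset sub1set yF sIF cardsU1 yI cI ltnn => /(_ isT).
  have [B tB yB] := tight_witness iI (subsetP sF _ yF) dy; case/andP: (tB) => sB leB.
  rewrite (mem_block sB eE ye) in yB; apply/subsetP=> z ze.
  have zB : z \in 'S_ B by rewrite (mem_block sB eE ze).
  apply: contraT => zF; have /(forall_inP fF) : z \in 'S_ E :\: F.
    by rewrite inE zF (mem_block _ eE ze).
  have [K [iK sKF <-]] := rank_witness N (z |: F); rewrite -cI => lt_IK.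
  have [x /setDP[xK xI] ixI] := indep_aug iI iK lt_IK.
  have : x \in z |: F := subsetP sKF _ xK; case/setU1P=> [xz|xF].
    subst x; case/xindepP: ixI => _ /(_ B sB); rewrite leqNgt => /negP[].
    apply: leq_ltn_trans leB _; apply: proper_card; apply/properP.
    split; first by rewrite setSI // subsetUr.
    by exists z; rewrite !inE ?eqxx ?zB // (negPf xI).
  have := @rank_ge _ N F _ ixI.
  by rewrite subUset sub1set xF sIF cardsU1 xI cI ltnn => /(_ isT).
pose A := [set e in E | S e \subset F].
have sA : A \subset E by apply/subsetP=> e; rewrite inE => /andP[].
have FA : F = 'S_ A.
  apply/setP=> y; apply/idP/mem_blockP => [yF|[e]]; last by rewrite inE => /andP[_ /subsetP]; apply.
  have [e eE ye] := mem_blockE (subsetP sF _ yF); exists e => //.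
  by rewrite inE eE (full e y).
exists A => //; apply/andP; split.
  rewrite /flat sA; apply/forall_inP=> e /setDP[eE eA]; have ie := block_mem blk eE.
  have /(forall_inP fF) : i e \in 'S_ E :\: F.
    by rewrite inE FA !(mem_block _ eE ie) ?eA.
  have seA : e |: A \subset E by rewrite subUset sub1set eE.
  rewrite {1}FA rank_block // => lt1.
  rewrite -(ltn_pmul2l (t_gt0 eE)) (leq_trans lt1) // -rank_block //.
  apply: rankS; rewrite FA block_unionU setSU // sub1set.
  by rewrite /block_union big_set1.
apply/forallP=> e; apply/negP=> /andP[/setIP[eE eA] /forallP eB].
have ie := block_mem blk eE.
have iF : i e \in F by rewrite FA (mem_block sA eE ie).
have [I [iI sIF cI iI']] := avoid _ iF.
have sA' : A :\ e \subset E by apply: subset_trans sA; rewrite subsetDl.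
have lt_r : r (A :\ e) < r A.
  rewrite ltn_neqAle rankS ?subsetDl // andbT; apply/eqP=> eq_r.
  have [J [iJ sJ cJ]] := rank_witness M (A :\ e).
  have /implyP := eB J; have -> : basis (restrict M A) J.
    by apply/basis_restrictP; split; rewrite ?cJ // (subset_trans sJ) ?subsetDl.
  by move=> /(_ isT) /(subsetP sJ); rewrite !inE eqxx.
have : #|I| < t * r A.
  apply: leq_trans (_ : t * (r (A :\ e)).+1 <= _); last by rewrite leq_mul2l lt_r orbT.
  rewrite mulnS -(cardsID 'S_(A :\ e) I) addnC -addSn leq_add //; last first.
    by case/xindepP: iI => _; apply.
  rewrite -(block_card blk eE); apply: proper_card; apply/properP; split; last first.
    by exists (i e); rewrite // !inE (negPf iI') andbF.
  apply/subsetP=> y /setDP[yI yA]; have := subsetP sIF _ yI; rewrite FA.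
  rewrite -(setD1K eA) block_unionU inE (negPf yA) orbF.
  by rewrite /block_union big_set1.
by rewrite cI FA rank_block // ltnn.
Qed.

Lemma free_expansionP : is_expansion t M i S free_expansion.
Proof.
split=> // [F|A /andP[/andP[sA _] _]]; last exact: rank_block.
by split=> [|[A cA ->]]; [apply: block_cyclic_flat | apply: cyclic_flat_block].
Qed.

End ExpansionExistence.

Lemma expansion_exists (T : finType) (t : nat) (M : matroid T) : 0 < t ->
  exists (U : finType) (i : T -> U) (S : T -> {set U}) (N : matroid U),
    is_expansion t M i S N.
Proof.
case: t => // t _; exists (T * 'I_t.+1)%type, (fun e => (e, ord0)).
pose S e : {set T * 'I_t.+1} := setX [set e] [set: 'I_t.+1].
suff blk : expansion_blocks t.+1 M (fun e => (e, ord0)) S.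
  by exists S, (free_expansion blk); apply: free_expansionP.
split=> [e _|e _|e f _ _ ne].
- by rewrite !inE eqxx.
- by rewrite cardsX cards1 cardsT card_ord mul1n.
by apply/pred0P=> -[x j]; rewrite /= !inE !andbT; apply/andP=> -[/eqP-> /eqP ef]; rewrite ef eqxx in ne.
Qed.

(* Main.v *)
Require Import Defs.
From mathcomp Require Import all_boot.

(** A matroid M on E is transversal iff there are multiplicities m(B), for B a
    cyclic flat, such that r(A) = sum of m(B) over the cyclic flats B that do not
    contain A, for every cyclic flat A, and r(X) is at most that sum for every X:
    the sets E - B, each repeated m(B) times, then present M by Hall's theorem,
    and conversely each set D of a presentation may be enlarged until E - D is
    the union of the circuits it contains, which turns out to be a flat.
    The cyclic flats of the t-expansion are those of M blown up, and all ranks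
    r(S_X) are multiplied by t; hence multiplicities for M give multiplicities
    for the expansion on multiplication by t. Conversely the equations for the
    cyclic flats, solved from the top downwards, show that multiplicities for
    the expansion are divisible by t, except for that of the largest cyclic
    flat, which is only constrained from below.
    For the fundamental case, a basis Y of the expansion meeting every S_A in
    t * r(A) elements makes r modular on the ring of sets A with this property,
    and a basis of M adapted to a maximal chain of this ring meets every member A
    in r(A) elements. *)

Set Implicit Arguments.
Unset Strict Implicit.
Unset Printing Implicit Defensive.

(** * Hall's marriage theorem *)

Lemma hall (T J : finType) (j0 : J) (R : T -> {set J}) (X : {set T}) :
  (forall Y : {set T}, Y \subset X -> #|Y| <= #|\bigcup_(y in Y) R y|) ->
  exists2 f : T -> J, {in X &, injective f} & {in X, forall x, f x \in R x}.
Proof.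
have [n] := ubnP #|X|; elim: n R X => // n IHn R X ltXn hallX.
have [->|[x0 x0X]] := set_0Vmem X.
  (* [f] is total, so the default value [j0] is needed even with nothing to match. *)
  by exists (fun=> j0) => [x y|x]; rewrite inE.
(* If some nonempty proper [Y] is critical, match [Y] inside its neighbourhood [NY] and the rest
   outside [NY]. Otherwise every such set has a neighbour to spare, and [x0] may take any [j] in
   [R x0]. *)
have [/existsP[Y]|/existsPn noY] := boolP [exists Y : {set T},
  [&& Y \proper X, Y != set0 & #|\bigcup_(y in Y) R y| <= #|Y|]].
  case/and3P=> pYX Y0 leY; have sYX := proper_sub pYX.
  set NY := \bigcup_(y in Y) R y in leY.
  have [||f1 inj1 mem1] := IHn R Y.
  - exact: leq_trans (proper_card pYX) _.
  - by move=> Z sZY; apply: hallX; apply: subset_trans sYX.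
  have [||f2 inj2 mem2] := IHn (fun x => R x :\: NY) (X :\: Y).
  - have := cardsID Y X; rewrite (setIidPr sYX) => eX.
    rewrite -ltnS (leq_trans _ ltXn) // ltnS -eX -add1n leq_add2r.
    by rewrite card_gt0.
  - move=> Z sZ; have dYZ : Y :&: Z = set0.
      apply/setP=> x; rewrite !inE; apply/andP=> -[xY /(subsetP sZ)].
      by rewrite inE xY.
    have sZX : Y :|: Z \subset X.
      by rewrite subUset sYX (subset_trans sZ) ?subsetDl.
    have := hallX _ sZX; rewrite cardsU dYZ cards0 subn0 bigcup_setU -/NY => h.
    rewrite -(leq_add2l #|Y|) (leq_trans h) //.
    apply: leq_trans (leq_add leY (leqnn _)).
    apply: leq_trans (leq_card_setU _ _); apply: subset_leq_card.
    apply/subsetP=> j; rewrite !inE => /orP[->//|/bigcupP[z zZ jz]].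
    by case: (boolP (j \in NY)) => //= jNY; apply/bigcupP; exists z; rewrite // inE jNY.
  exists (fun x => if x \in Y then f1 x else f2 x) => [x y xX yX|x xX].
    have [xY|xY] := boolP (x \in Y); have [yY|yY] := boolP (y \in Y).
    - exact: inj1.
    - move=> e; have := mem2 y; rewrite !inE yY yX -e => /(_ isT) /andP[/bigcupP[]].
      by exists x; rewrite ?mem1.
    - move=> e; have := mem2 x; rewrite !inE xY xX e => /(_ isT) /andP[/bigcupP[]].
      by exists y; rewrite ?mem1.
    - by apply: inj2; rewrite inE ?xY ?yY.
  have [xY|xY] := boolP (x \in Y); first exact: mem1.
  by have := mem2 x; rewrite !inE xY xX => /(_ isT) /andP[].
have /card_gt0P[j jx0] : 0 < #|R x0|.
  by have := hallX [set x0]; rewrite sub1set x0X cards1 big_set1 => /(_ isT).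
have [||f inj mem] := IHn (fun x => R x :\ j) (X :\ x0).
- by move: ltXn; rewrite (cardsD1 x0) x0X.
- move=> Z sZ; have [->|Z0] := eqVneq Z set0; first by rewrite cards0.
  have pZ : Z \proper X.
    by apply: sub_proper_trans sZ _; rewrite properD1.
  have := noY Z; rewrite pZ Z0 /= -ltnNge => /leq_trans ltZ.
  rewrite -ltnS; apply: ltZ; rewrite -add1n -(cards1 j).
  apply: leq_trans (leq_card_setU _ _); apply: subset_leq_card.
  apply/subsetP=> k /bigcupP[z zZ kz]; rewrite !inE.
  by case: eqVneq => //= kj; apply/bigcupP; exists z; rewrite // !inE kj.
exists (fun x => if x == x0 then j else f x) => [x y xX yX|x xX].
  case: (eqVneq x x0) => [->|xx]; case: (eqVneq y x0) => [->|yy] //.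
  - by move=> e; have := mem y; rewrite !inE yy yX -e eqxx => /(_ isT).
  - by move=> e; have := mem x; rewrite !inE xx xX e eqxx => /(_ isT).
  - by apply: inj; rewrite !inE ?xx ?yy.
case: (eqVneq x x0) => [->//|xx].
by have := mem x; rewrite !inE xx xX => /(_ isT) /andP[].
Qed.

(** * Hall's condition for a family of sets *)

Section FamilyDegree.
Variable T : finType.

(** The neighbourhood of [Y] in the bipartite graph of elements and indices. *)
Definition met (J : finType) (D : J -> {set T}) (Y : {set T}) : {set J} :=
  [set j | ~~ [disjoint Y & D j]].

Definition degree (J : finType) (D : J -> {set T}) (Y : {set T}) : nat :=
  #|met D Y|.

Lemma metP (J : finType) (D : J -> {set T}) (Y : {set T}) j :
  reflect (exists2 y, y \in Y & y \in D j) (j \in met D Y).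
Proof.
rewrite inE; apply: (iffP pred0Pn) => [[y /andP[]]|[y yY yD]]; first by exists y.
by exists y; apply/andP.
Qed.

Lemma metS (J : finType) (D : J -> {set T}) (X Y : {set T}) :
  X \subset Y -> met D X \subset met D Y.
Proof.
by move=> /subsetP sXY; apply/subsetP=> j /metP[x /sXY xY xD]; apply/metP; exists x.
Qed.

Lemma degreeS (J : finType) (D : J -> {set T}) (X Y : {set T}) :
  X \subset Y -> degree D X <= degree D Y.
Proof. by move=> /(metS D)/subset_leq_card. Qed.

Lemma degree_submod (J : finType) (D : J -> {set T}) (X Y : {set T}) :
  degree D (X :|: Y) + degree D (X :&: Y) <= degree D X + degree D Y.
Proof.
rewrite /degree -[leqRHS]cardsUI; apply: leq_add; apply: subset_leq_card; last first.
  by rewrite subsetI !metS ?subsetIl ?subsetIr.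
apply/subsetP=> j /metP[x /setUP[] xX xD]; rewrite in_setU;
  apply/orP; [left|right]; by apply/metP; exists x.
Qed.

Lemma partial_transversal_hall n (D : 'I_n -> {set T}) (X : {set T}) :
  partial_transversal D X <->
  forall Y : {set T}, Y \subset X -> #|Y| <= degree D Y.
Proof.
split=> [[f inj_f mem_f] Y sYX|hallX].
  pose P := [set u : {x | x \in X} | val u \in Y].
  have -> : Y = val @: P.
    apply/setP=> y; apply/idP/imsetP=> [yY|[u]]; last by rewrite inE => ? ->.
    by exists (Sub y (subsetP sYX _ yY)); rewrite ?inE.
  rewrite card_imset; last exact: val_inj.
  rewrite -(card_imset _ inj_f); apply/subset_leq_card/subsetP=> _ /imsetP[u uP ->].
  rewrite inE; apply/pred0Pn; exists (val u); rewrite /= mem_f andbT.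
  exact: imset_f.
(* For empty [X] the type ['I_n] may be empty too, leaving no [j0] for [hall]; the empty map serves
   instead. *)
have [X0|[x0 x0X]] := set_0Vmem X.
  have f0 (u : {x | x \in X}) : False by case: u => x; rewrite X0 inE.
  by exists (fun u => match f0 u with end) => u; case: (f0 u).
have /card_gt0P[j0 _] : 0 < degree D [set x0].
  by rewrite (leq_trans _ (hallX _ _)) ?cards1 ?sub1set.
have [|f inj_f mem_f] := @hall T 'I_n j0 (fun x => [set j | x \in D j]) X.
  move=> Y /hallX /leq_trans; apply; apply/subset_leq_card/subsetP=> j.
  by rewrite inE => /pred0Pn[y /andP[yY yj]]; apply/bigcupP; exists y; rewrite ?inE.
exists (fun u => f (val u)) => [u v /inj_f uv|u].
  by apply/val_inj/uv; apply: valP.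
by have := mem_f _ (valP u); rewrite inE.
Qed.

(** Allows any finite index type, such as the copies of cyclic flats used below. *)
Lemma transversal_of_family (M : matroid T) (J : finType) (D : J -> {set T}) :
  (forall j, D j \subset ground M) ->
  (forall X, indep M X <-> forall Y : {set T}, Y \subset X -> #|Y| <= degree D Y) ->
  transversal_matroid M.
Proof.
move=> sD hM; exists #|J|, (fun k => D (enum_val k)); split=> // X.
have degE Y : degree (fun k : 'I_#|J| => D (enum_val k)) Y = degree D Y.
  rewrite /degree -(card_imset _ enum_val_inj); apply: eq_card => j.
  rewrite inE; apply/imsetP/idP=> [[k]|h]; first by rewrite inE => ? ->.
  by exists (enum_rank j); rewrite ?inE enum_rankK.
apply: iff_trans (hM X) _; apply: iff_sym; apply: iff_trans (partial_transversal_hall _ _) _.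
by split=> h Y /h; rewrite degE.
Qed.

End FamilyDegree.

(** * Unions of circuits and cyclic flats *)

Section CyclicSets.
Variables (T : finType) (M : matroid T).
Implicit Types (X Y A B C F I : {set T}) (e x : T).

Local Notation E := (ground M).
Local Notation r := (rank M).

(** These are the unions of circuits; they need not be closed. *)
Definition cyclic_set X : bool :=
  (X \subset E) && [forall e in X, r (X :\ e) == r X].

Lemma cyclic_setP X :
  reflect (X \subset E /\ forall e, e \in X -> r (X :\ e) = r X) (cyclic_set X).
Proof.
apply: (iffP andP) => -[sX h]; split=> //; first by move=> e /(forall_inP h)/eqP.
by apply/forall_inP=> e /h ->.
Qed.

Lemma indep_rankP I : I \subset E -> indep M I = (#|I| <= r I).
Proof.
move=> sI; apply/idP/idP=> [/rank_indep->//|leI].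
have [J [iJ sJ cJ]] := rank_witness M I.
suff <- : J = I by [].
by apply/eqP; rewrite eqEcard sJ cJ.
Qed.

(** By submodularity, an element spanned by [X] is spanned by every larger set. *)
Lemma rankU1_mono X Y e : X \subset Y -> r (e |: X) = r X -> r (e |: Y) = r Y.
Proof.
move=> sXY eqX; apply/eqP; rewrite eqn_leq [X in _ && X]rankS ?subsetUr // andbT.
have := rank_submod M (e |: X) Y; rewrite -setUA (setUidPr sXY) eqX addnC.
have sX : X \subset (e |: X) :&: Y by rewrite subsetI subsetUr.
by move=> h; have := leq_trans (leq_add (rankS M sX) (leqnn _)) h; rewrite leq_add2l.
Qed.

Lemma rankU1_ltn X e : r (e |: X) <> r X -> r X < r (e |: X).
Proof.
by move=> ne; rewrite ltn_neqAle rankS ?subsetUr // andbT; apply/eqP=> /esym.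
Qed.

Lemma cyclic_flatE F : cyclic_flat M F = flat M F && cyclic_set F.
Proof.
rewrite /cyclic_flat; case fF: (flat M F) => //=.
have /andP[sF _] := fF; rewrite /cyclic_set sF /=.
apply/forallP/forall_inP=> [h e eF|h e].
  have := h e; rewrite negb_and inE eF (subsetP sF) //= => /forallPn[I].
  rewrite negb_imply => /andP[/basis_restrictP[iI sIF cI] eI].
  rewrite eqn_leq rankS ?subsetDl // -cI rank_ge // subsetD1 sIF; exact: eI.
apply/negP=> /andP[/setIP[eE eF] /forallP eB].
have [I [iI sI cI]] := rank_witness M (F :\ e).
have /implyP := eB I.
have -> : basis (restrict M F) I.
  apply/basis_restrictP; split=> //; last by rewrite cI (eqP (h e eF)).
  exact: subset_trans sI (subsetDl _ _).
by move=> /(_ isT) /(subsetP sI); rewrite !inE eqxx.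
Qed.

Lemma flat_of_rank F : F \subset E ->
  (forall e, e \in E -> r (e |: F) = r F -> e \in F) -> flat M F.
Proof.
move=> sF h; rewrite /flat sF; apply/forall_inP=> e /setDP[eE eF].
by apply: rankU1_ltn => // /(h e eE); rewrite (negPf eF).
Qed.

Lemma cyclic_set0 : cyclic_set set0.
Proof. by apply/cyclic_setP; rewrite sub0set; split=> // e; rewrite inE. Qed.

Lemma cyclic_setU X Y : cyclic_set X -> cyclic_set Y -> cyclic_set (X :|: Y).
Proof.
move=> /cyclic_setP[sX hX] /cyclic_setP[sY hY]; apply/cyclic_setP.
have half A B e : (forall f, f \in A -> r (A :\ f) = r A) -> e \in A ->
    r ((A :|: B) :\ e) = r (A :|: B).
  move=> hA eA; have sA : A :\ e \subset (A :|: B) :\ e by rewrite setSD ?subsetUl.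
  have := @rankU1_mono _ _ e sA; rewrite !setD1K ?inE ?eA //.
  by move=> /(_ (esym (hA e eA))) ->.
split=> [|e]; first by rewrite subUset sX.
case/setUP=> [eX|eY]; first exact: half.
by rewrite setUC half.
Qed.

Lemma cyclic_setU1 X e : cyclic_set X -> e \in E -> r (e |: X) = r X ->
  cyclic_set (e |: X).
Proof.
move=> cX eE eqX; have [eX|eX] := boolP (e \in X); first by rewrite (setUidPr _) ?sub1set.
have /cyclic_setP[sX hX] := cX; apply/cyclic_setP.
split=> [|f]; first by rewrite subUset sub1set eE.
case/setU1P=> [->|fX]; first by rewrite setU1K // eqX.
apply/eqP; rewrite eqn_leq rankS ?subsetDl // eqX -(hX f fX) rankS //.
by rewrite setSD // subsetUr.
Qed.

(** The union of the circuits inside [X]. *)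
Definition cyclic_core X : {set T} := \bigcup_(C | cyclic_set C && (C \subset X)) C.

Lemma cyclic_core_cyclic X : cyclic_set (cyclic_core X).
Proof.
apply: (big_ind cyclic_set) => [|A B|C /andP[]//]; first exact: cyclic_set0.
exact: cyclic_setU.
Qed.

Lemma cyclic_core_sub X : cyclic_core X \subset X.
Proof. by apply/bigcupsP=> C /andP[]. Qed.

Lemma cyclic_core_max X C : cyclic_set C -> C \subset X -> C \subset cyclic_core X.
Proof. by move=> cC sC; apply: bigcup_sup; rewrite cC. Qed.

(** An element spanned by the core could be added to it and leave it cyclic, so it is there
    already. *)
Lemma cyclic_flat_core : cyclic_flat M (cyclic_core E).
Proof.
have cK := cyclic_core_cyclic E; rewrite cyclic_flatE cK andbT.
apply: flat_of_rank => [|e eE eqK]; first exact: cyclic_core_sub.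
have ceK := cyclic_setU1 cK eE eqK.
have /subsetP := cyclic_core_max ceK (proj1 (cyclic_setP _ ceK)); apply.
by rewrite !inE eqxx.
Qed.

(** The witness is a circuit inside [X]. *)
Lemma dependent_cyclic_set X : X \subset E -> ~~ indep M X ->
  exists2 C, cyclic_set C & r C < #|X :&: C|.
Proof.
move=> sX dX.
have [|C /minsetP[/= dC minC] sCX] := @minset_exists _ (fun C => ~~ indep M C) X.
  exact: dX.
have sC := subset_trans sCX sX.
have ltC : r C < #|C| by rewrite ltnNge -indep_rankP.
exists C; last by rewrite (setIidPr sCX).
apply/cyclic_setP; split=> // e eC; apply/eqP; rewrite eqn_leq rankS ?subsetDl //=.
have iCe : indep M (C :\ e).
  apply: contraT => /minC/(_ (subsetDl _ _))/setP/(_ e).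
  by rewrite !inE eqxx eC.
by rewrite (rank_indep iCe) -ltnS (leq_trans ltC) // (cardsD1 e) eC.
Qed.

(* A cyclic set that violates the bound and is maximal is automatically closed. *)
Lemma indep_cyclic_flats X : X \subset E ->
  (forall F, cyclic_flat M F -> #|X :&: F| <= r F) -> indep M X.
Proof.
move=> sX h; apply: contraT => /(dependent_cyclic_set sX)[C cC ltC].
have [|F /maxsetP[/andP[cF ltF] maxF] _] :=
  @maxset_exists _ (fun C => cyclic_set C && (r C < #|X :&: C|)) C.
  by rewrite cC.
suff fF : flat M F by have := h F; rewrite cyclic_flatE fF cF leqNgt ltF => /(_ isT).
have [sF _] := cyclic_setP _ cF; apply: flat_of_rank => // e eE eqF.
suff <- : e |: F = F by rewrite setU11.
apply: maxF; rewrite ?subsetUr // cyclic_setU1 //= eqF (leq_trans ltF) //.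
by rewrite subset_leq_card // setIS // subsetUr.
Qed.

End CyclicSets.

(** * Rank and degree in a presentation *)

Section Presentation.
Variables (T : finType) (M : matroid T) (J : finType) (D : J -> {set T}).
Implicit Types X Y A B I : {set T}.

Local Notation E := (ground M).
Local Notation r := (rank M).

Hypothesis indepD : forall X,
  indep M X <-> forall Y : {set T}, Y \subset X -> #|Y| <= degree D Y.

Lemma rank_le_degree X : r X <= degree D X.
Proof.
apply: rank_le => I /indepD/(_ I (subxx _)) leI sIX.
exact: leq_trans leI (degreeS _ sIX).
Qed.

(* With I a basis of X and Y the largest subset of I for which Hall's condition *)
(* is an equality, all the sets that meet X :\: I already meet Y; an element of *)
(* I :\: Y would then lie in every basis of X.                                  *)
Lemma rank_cyclic_set X : cyclic_set M X -> r X = degree D X.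
Proof.
move=> /cyclic_setP[sX cX]; apply/eqP; rewrite eqn_leq rank_le_degree /=.
have [I [iI sIX cI]] := rank_witness M X.
have hallI : forall Y : {set T}, Y \subset I -> #|Y| <= degree D Y by apply/indepD.
pose tight Y := (Y \subset I) && (degree D Y <= #|Y|).
have tight0 : tight set0.
  rewrite /tight sub0set cards0 leqn0 cards_eq0 /=; apply/eqP/setP=> j.
  by rewrite in_set0; apply/metP=> -[x]; rewrite inE.
have tightU Y Z : tight Y -> tight Z -> tight (Y :|: Z).
  case/andP=> sY tY /andP[sZ tZ]; rewrite /tight subUset sY sZ /=.
  have sYZ : Y :&: Z \subset I by rewrite subIset ?sY.
  rewrite -(leq_add2r #|Y :&: Z|) cardsUI (leq_trans _ (leq_add tY tZ)) //.
  by rewrite (leq_trans _ (degree_submod _ _ _)) // leq_add2l hallI.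
pose Y := \bigcup_(Z | tight Z) Z.
have /andP[sYI tY] : tight Y by apply: (big_ind tight).
have metY e : e \in X :\: I -> met D [set e] \subset met D Y.
  case/setDP=> eX eI; have eE := subsetP sX _ eX.
  (* As [I] is a basis of [X], some [Z] in [e |: I] violates Hall's condition. It contains [e], and
     [Z :\ e] is tight and meets the same sets as [Z]. *)
  have /existsP[Z /andP[sZ ltZ]] :
      [exists Z : {set T}, (Z \subset e |: I) && (degree D Z < #|Z|)].
    apply: contraT => /existsPn noZ.
    have ieI : indep M (e |: I).
      by apply/indepD=> Z sZ; have := noZ Z; rewrite sZ -leqNgt.
    have := rank_ge ieI (_ : e |: I \subset X).
    by rewrite subUset sub1set eX sIX cardsU1 eI cI ltnn => /(_ isT).
  have sZI : Z :\ e \subset I by rewrite subDset.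
  have eZ : e \in Z.
    apply: contraLR ltZ => eZ; rewrite -leqNgt hallI //.
    by move: sZI; rewrite (setDidPl _) // disjoint_sym disjoints1.
  have leZ : degree D Z <= #|Z :\ e| by move: ltZ; rewrite (cardsD1 e Z) eZ.
  have tZ : tight (Z :\ e).
    by rewrite /tight sZI (leq_trans (degreeS _ (subsetDl _ _))).
  have eqZ : met D (Z :\ e) = met D Z.
    apply/eqP; rewrite eqEcard metS ?subsetDl //=.
    exact: leq_trans leZ (hallI _ sZI).
  apply: subset_trans (metS D (bigcup_sup (Z :\ e) tZ)).
  by rewrite eqZ metS // sub1set.
pose W := Y :|: (X :\: I).
have leW : degree D W <= #|Y|.
  apply: leq_trans tY; apply/subset_leq_card/subsetP=> j /metP[x /setUP[xY|xX] xD].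
    by apply/metP; exists x.
  by apply: (subsetP (metY x xX)); apply/metP; exists x; rewrite ?inE.
have [sIY|/subsetPn[e eI eY]] := boolP (I \subset Y).
  rewrite -cI (leq_trans (degreeS D (_ : X \subset W))) //; last first.
    by rewrite (leq_trans leW) // subset_leq_card.
  apply/subsetP=> x xX; rewrite !inE xX andbT.
  by case: (boolP (x \in I)) => [/(subsetP sIY)->|]; rewrite ?orbT.
have eX := subsetP sIX _ eI.
have [K [iK sK cK]] := rank_witness M (X :\ e).
(* [K] has at most [degree D W <= #|Y|] elements in [W]; its other elements lie in [I :\: Y] and
   omit [e]. *)
have : #|K| < #|I|; last by rewrite cK cX // cI ltnn.
rewrite -(cardsID W K) -(cardsID Y I) (setIidPr sYI) -addnS leq_add //.
  apply: leq_trans leW; apply: leq_trans (degreeS D (subsetIr K W)).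
  by move/indepD: iK; apply; rewrite subsetIl.
apply: proper_card; apply/properP; split; last first.
  exists e; first by rewrite inE eY.
  by apply/negP=> /setDP[/(subsetP sK)]; rewrite !inE eqxx.
apply/subsetP=> x; rewrite !inE negb_or => /andP[/andP[-> xXI] /(subsetP sK)].
by rewrite !inE => /andP[_ xX]; move: xXI; rewrite xX andbT negbK.
Qed.

(** Adding a spanned element of [D j] to the core would give a cyclic set of equal rank that meets
    one more set, [D j]; but rank equals degree on cyclic sets. *)
Lemma cyclic_flat_core_setD j : cyclic_flat M (cyclic_core M (E :\: D j)).
Proof.
set B := cyclic_core M _; have cB : cyclic_set M B := cyclic_core_cyclic _ _.
have sB : B \subset E :\: D j := cyclic_core_sub _ _.
rewrite cyclic_flatE cB andbT; apply: flat_of_rank => [|e eE eqB].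
  exact: subset_trans sB (subsetDl _ _).
have ceB := cyclic_setU1 cB eE eqB.
have [eD|eD] := boolP (e \in D j); last first.
  have seB : e |: B \subset E :\: D j by rewrite subUset sB sub1set inE eD eE.
  exact: subsetP (cyclic_core_max ceB seB) _ (setU11 _ _).
move: eqB; rewrite !rank_cyclic_set // => eqB.
suff : degree D B < degree D (e |: B) by rewrite eqB ltnn.
apply: proper_card; apply/properP; split; first by rewrite metS ?subsetUr.
exists j; first by apply/metP; exists e; rewrite ?setU11.
by apply/metP=> -[x /(subsetP sB)]; rewrite inE => /andP[/negPf->].
Qed.

End Presentation.

(** * Presentations by complements of cyclic flats *)

Section Weights.
Variables (T : finType) (M : matroid T).
Implicit Types X Y A B : {set T}.

Local Notation E := (ground M).
Local Notation r := (rank M).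

(** A subset [Y] of [E] meets [E :\: B] exactly when [B] does not contain it, so this is the degree
    of [Y] in the family of these complements. *)
Definition flat_weight (m : {set T} -> nat) Y : nat :=
  \sum_(B | cyclic_flat M B && ~~ (Y \subset B)) m B.

(* [m B] is the multiplicity of [E :\: B] in a presentation of M by complements *)
(* of cyclic flats.                                                             *)
Definition presenting (m : {set T} -> nat) : Prop :=
  (forall A, cyclic_flat M A -> flat_weight m A = r A) /\
  (forall X, X \subset E -> r X <= flat_weight m X).

Lemma cyclic_flat_sub A : cyclic_flat M A -> A \subset E.
Proof. by case/andP=> /andP[]. Qed.

(** Each [D j] is enlarged to the complement of the core of [E :\: D j]. The same cyclic sets meet
    it as before, and degrees of other sets can only grow. *)
Lemma presenting_of_transversal : transversal_matroid M -> exists m, presenting m.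
Proof.
case=> n [D [sD hM]].
have indepD X : indep M X <-> forall Y, Y \subset X -> #|Y| <= degree D Y.
  exact: iff_trans (hM X) (partial_transversal_hall _ _).
pose b j := cyclic_core M (E :\: D j).
exists (fun B => #|[set j | b j == B]|).
have weightE Y : flat_weight (fun B => #|[set j | b j == B]|) Y =
    #|[set j | ~~ (Y \subset b j)]|.
  rewrite -sum1dep_card /flat_weight.
  rewrite (partition_big b (fun B => cyclic_flat M B && ~~ (Y \subset B))) /=.
    apply: eq_bigr => B /andP[_ nYB]; rewrite -sum1dep_card; apply: eq_bigl => j.
    by case: eqVneq => [->|]; rewrite ?andbF ?nYB.
  by move=> j ->; rewrite (cyclic_flat_core_setD indepD).
split=> [A cA|X sX]; rewrite weightE.
  have cA' : cyclic_set M A by move: cA; rewrite cyclic_flatE => /andP[].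
  rewrite (rank_cyclic_set indepD cA'); apply: eq_card => j; rewrite !inE; congr (~~ _).
  apply/idP/idP=> [/subset_trans/(_ (cyclic_core_sub _ _))|dA].
    by rewrite subsetD => /andP[].
  by apply: cyclic_core_max; rewrite // subsetD cyclic_flat_sub.
apply: leq_trans (rank_le_degree indepD X) _; apply/subset_leq_card/subsetP=> j.
rewrite !inE; apply: contra => /subset_trans/(_ (cyclic_core_sub _ _)).
by rewrite subsetD => /andP[].
Qed.

Lemma transversal_of_presenting m : presenting m -> transversal_matroid M.
Proof.
(* The factor [cyclic_flat M B] leaves no copies of sets that are not cyclic flats. *)
case=> eq_m le_m; pose m' B := cyclic_flat M B * m B.
pose D (j : {B : {set T} & 'I_(m' B)}) := E :\: tag j.
have degD Y : Y \subset E -> degree D Y = flat_weight m Y.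
  move=> sY; rewrite /degree -sum1_card /flat_weight.
  rewrite (eq_bigl (fun j : {B : {set T} & 'I_(m' B)} => ~~ (Y \subset tag j) && true)); last first.
    by move=> j; rewrite inE andbT -setI_eq0 setIDA (setIidPl sY) setD_eq0.
  rewrite -(sig_big_dep (fun B => ~~ (Y \subset B)) (fun _ _ => true) (fun _ _ => 1)) /=.
  rewrite [RHS]big_mkcondl /=; apply: eq_bigr => B _.
  by rewrite sum1_card card_ord /m'; case: (cyclic_flat M B); rewrite ?mul1n.
apply: (@transversal_of_family _ _ _ D) => [j|X]; first exact: subsetDl.
split=> [iX Y sYX|hallX].
  have iY := indepS sYX iX; have sY := indep_ground iY.
  by rewrite degD // -(rank_indep iY) le_m.
(* An element outside [E] meets no [D j], against Hall's condition for its singleton. *)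
have sX : X \subset E.
  apply/subsetP=> x xX; have /card_gt0P[j] : 0 < degree D [set x].
    by rewrite (leq_trans _ (hallX _ _)) ?cards1 ?sub1set.
  by case/metP=> y; rewrite !inE => /eqP-> /andP[].
apply: indep_cyclic_flats => // A cA; have sA := cyclic_flat_sub cA.
apply: leq_trans (hallX _ (subsetIl _ _)) _.
by rewrite (leq_trans (degreeS D (subsetIr X A))) // degD // eq_m.
Qed.

End Weights.

(** * Cyclic flats as a complete invariant; bases adapted to a ring of sets *)

Lemma eq_indep_cyclic_flats (T : finType) (M N : matroid T) :
  ground M = ground N -> cyclic_flat M =1 cyclic_flat N ->
  (forall F, cyclic_flat M F -> rank M F = rank N F) -> indep M =1 indep N.
Proof.
have half (M1 M2 : matroid T) X : ground M1 = ground M2 ->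
    cyclic_flat M1 =1 cyclic_flat M2 ->
    (forall F, cyclic_flat M1 F -> rank M1 F = rank M2 F) ->
    indep M1 X -> indep M2 X.
  move=> eqE eqF eqr iX; apply: indep_cyclic_flats => [|F cF].
    by rewrite -eqE indep_ground.
  rewrite -eqF in cF; rewrite -eqr // rank_ge ?subsetIr //.
  by apply: indepS iX; rewrite subsetIl.
move=> eqE eqF eqr X; apply/idP/idP; apply: half => // F cF.
by rewrite eqr // eqF.
Qed.

Lemma eq_rank (T : finType) (M N : matroid T) : indep M =1 indep N -> rank M =1 rank N.
Proof. by move=> eqI X; apply: eq_bigl => I; rewrite eqI. Qed.

Lemma basis_rankP (T : finType) (M : matroid T) (B : {set T}) :
  reflect (indep M B /\ #|B| = rank M (ground M)) (basis M B).
Proof.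
apply: (iffP maxsetP) => [[iB maxB]|[iB cB]].
  split=> //; have [K [iK sBK _ cK]] := rank_extend iB (indep_ground iB).
  by rewrite -cK (maxB K).
split=> // K iK sBK; apply/esym/eqP; rewrite eqEcard sBK cB.
by rewrite rank_ge // indep_ground.
Qed.

(* Induction along a maximal chain of L: for A in L and L' the predecessor of K *)
(* in the chain, A :|: L' is either L' or K.                                     *)
Lemma modular_ring_indep (T : finType) (M : matroid T) (L : pred {set T}) :
  L set0 ->
  (forall A B, L A -> L B -> L (A :|: B)) ->
  (forall A B, L A -> L B -> L (A :&: B)) ->
  (forall A B, L A -> L B ->
    rank M (A :|: B) + rank M (A :&: B) = rank M A + rank M B) ->
  forall K, L K -> exists I, [/\ indep M I, I \subset K &
    forall A : {set T}, L A -> A \subset K -> #|I :&: A| = rank M A].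
Proof.
move=> L0 LU LI Lmod K; have [n] := ubnP #|K|; elim: n K => // n IHn K ltK LK.
have [->|K0] := eqVneq K set0.
  exists set0; split; rewrite ?indep0 // => A _; rewrite subset0 => /eqP->.
  by rewrite set0I cards0 rank0.
have [|L' /maxsetP[/andP[LL' pL'] maxL'] _] :=
  @maxset_exists _ (fun A : {set T} => L A && (A \proper K)) set0.
  by rewrite L0 proper0.
have sL' := proper_sub pL'.
have [|//|I' [iI' sI' cI']] := IHn L'; first exact: leq_trans (proper_card pL') _.
have [I [iI sI'I sIK cI]] := rank_extend iI' (subset_trans sI' sL').
have II' : I :&: L' = I'.
  apply/esym/eqP; rewrite eqEcard subsetI sI'I sI' /=.
  rewrite -(setIidPl sI') cI' // rank_ge ?subsetIr //.
  by apply: indepS iI; rewrite subsetIl.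
exists I; split=> // A LA sAK.
have [sAL'|nAL'] := boolP (A \subset L').
  by rewrite -{1}(setIidPr sAL') setIA II' cI'.
have eqK : A :|: L' = K.
  apply/eqP; rewrite eqEproper subUset sAK sL' /=; apply: contra nAL' => pA.
  by rewrite -(maxL' (A :|: L')) ?subsetUl ?subsetUr // LU.
(* Modularity for [A] and [L'] determines [#|I :&: A|], the counts on [K], [L'] and [A :&: L'] being
   known. *)
have := Lmod _ _ LA LL'; rewrite eqK -cI -(cI' L') // -(cI' (A :&: L')) ?LI ?subsetIr //.
have -> : I' :&: L' = I :&: L' by rewrite II' (setIidPl sI').
have -> : I' :&: (A :&: L') = (I :&: A) :&: (I :&: L').
  apply/setP=> x; rewrite II' !inE; case: (boolP (x \in I')) => xI'; rewrite ?andbF //.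
  by rewrite (subsetP sI'I) ?(subsetP sI') //= !andbT.
move=> h; apply/eqP; rewrite -(eqn_add2r #|I :&: L'|) -h -cardsUI -setIUr eqK.
by rewrite (setIidPl sIK).
Qed.

Definition fundamental_basis (T : finType) (M : matroid T) (B : {set T}) : Prop :=
  basis M B /\ forall F, cyclic_flat M F -> rank M F = #|F :&: B|.

(** * Transfer between a matroid and its expansion *)

Section Transfer.
Variables (T U : finType) (t : nat) (M : matroid T).
Variables (i : T -> U) (S : T -> {set U}) (Mt : matroid U).
Hypothesis hMt : is_expansion t M i S Mt.
Implicit Types (A B X : {set T}) (F Y : {set U}).

Local Notation E := (ground M).
Local Notation "'S_ X" := (block_union S X) (at level 8, X at level 2).
Local Notation r := (rank M).

Let blk := expansion_blocksP hMt.

(** Cyclic flats and their ranks determine a matroid, so [Mt] may be traded for the explicit model,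
    where the rank of every block union is known. *)
Lemma indep_expansion : indep Mt =1 indep (free_expansion blk).
Proof.
have hN := free_expansionP blk; apply: eq_indep_cyclic_flats => [|F|F].
- exact: expansion_ground hMt.
- apply/idP/idP=> [/(expansion_cyclic_flat hMt)|/(expansion_cyclic_flat hN)] h.
    exact/(expansion_cyclic_flat hN).
  exact/(expansion_cyclic_flat hMt).
case/(expansion_cyclic_flat hMt)=> A cA ->.
by rewrite (expansion_rank hMt) // (expansion_rank hN).
Qed.

Lemma rank_expansion A : A \subset E -> rank Mt 'S_ A = t * r A.
Proof. by rewrite (eq_rank indep_expansion); apply: rank_block. Qed.

Lemma block_union_sub A B : A \subset E -> B \subset E ->
  ('S_ A \subset 'S_ B) = (A \subset B).
Proof.
move=> sA sB; apply/idP/idP=> [sAB|]; last exact: block_unionS.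
apply/subsetP=> e eA; have eE := subsetP sA _ eA; have ie := block_mem blk eE.
by rewrite -(mem_block blk sB eE ie) (subsetP sAB) // (mem_block blk sA eE ie).
Qed.

(** For [Y] inside ['S_ E], the least set of elements whose blocks cover [Y]. *)
Definition block_support Y : {set T} := [set e in E | ~~ [disjoint Y & S e]].

Lemma block_support_sub Y : block_support Y \subset E.
Proof. by apply/subsetP=> e; rewrite inE => /andP[]. Qed.

Lemma sub_block_support Y : Y \subset 'S_ E -> Y \subset 'S_(block_support Y).
Proof.
move=> sY; apply/subsetP=> y yY; have /mem_blockP[e eE ye] := subsetP sY _ yY.
apply/mem_blockP; exists e => //; rewrite inE eE; apply/pred0Pn.
by exists y; apply/andP.
Qed.

Lemma block_support_subE Y A : Y \subset 'S_ E -> A \subset E ->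
  (Y \subset 'S_ A) = (block_support Y \subset A).
Proof.
move=> sY sA; apply/idP/idP=> [sYA|/block_unionS sS]; last first.
  exact: subset_trans (sub_block_support sY) (sS _ _).
apply/subsetP=> e; rewrite inE => /andP[eE /pred0Pn[y /andP[/= yY ye]]].
by rewrite -(mem_block blk sA eE ye) (subsetP sYA).
Qed.

Lemma block_support_union A : A \subset E -> block_support 'S_ A = A.
Proof.
move=> sA; have sSA : 'S_ A \subset 'S_ E by apply: block_unionS.
apply/eqP; rewrite eqEsubset -block_support_subE // subxx /=.
by rewrite -block_union_sub ?block_support_sub // sub_block_support.
Qed.

Lemma sum_expansion_cyclic_flats (P : pred {set U}) (g : {set U} -> nat) :
  \sum_(F | cyclic_flat Mt F && P F) g F =
  \sum_(A | cyclic_flat M A && P 'S_ A) g 'S_ A.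
Proof.
rewrite (reindex_onto (block_union S) block_support) /=; last first.
  move=> F /andP[/(expansion_cyclic_flat hMt)[A /cyclic_flat_sub sA ->] _].
  by rewrite block_support_union.
apply: eq_bigl => A; rewrite -andbA andbCA [RHS]andbC; congr (_ && _).
apply/andP/idP=> [[/(expansion_cyclic_flat hMt)[B cB ->]]|cA].
  by rewrite block_support_union ?cyclic_flat_sub // => /eqP <-.
split; first by apply/(expansion_cyclic_flat hMt); exists A.
by rewrite block_support_union ?cyclic_flat_sub.
Qed.

(** The weight of [Y] depends only on its block support, so filling up its blocks can only raise the
    rank, and the bound in [M] applies. *)
Lemma presenting_expansion m : presenting M m ->
  presenting Mt (fun F => t * m (block_support F)).
Proof.
case=> eq_m le_m.
have weightE Y : Y \subset 'S_ E -> flat_weight Mt (fun F => t * m (block_support F)) Y =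
    t * flat_weight M m (block_support Y).
  move=> sY; rewrite /flat_weight sum_expansion_cyclic_flats big_distrr /=.
  apply: eq_big => A; last by case/andP=> cA _; rewrite block_support_union ?cyclic_flat_sub.
  by case cA: (cyclic_flat M A); rewrite //= block_support_subE ?cyclic_flat_sub.
split=> [F|Y].
  case/(expansion_cyclic_flat hMt)=> A cA ->; have sA := cyclic_flat_sub cA.
  by rewrite weightE ?block_unionS // block_support_union // eq_m // rank_expansion.
rewrite (expansion_ground hMt) => sY; rewrite weightE //.
apply: leq_trans (rankS _ (sub_block_support sY)) _.
by rewrite rank_expansion ?block_support_sub // leq_mul2l le_m ?orbT ?block_support_sub.
Qed.

(* The weight of the largest cyclic flat occurs in none of the equations, so it *)
(* need not be divisible by t.                                                  *)
Lemma dvd_presenting_expansion m A : presenting Mt m -> cyclic_flat M A ->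
  A != cyclic_core M E -> t %| m 'S_ A.
Proof.
case=> eq_m _; have cE := cyclic_flat_core M; set K := cyclic_core M E in cE *.
have sK B : cyclic_flat M B -> B \subset K.
  move=> cB; apply: cyclic_core_max; rewrite ?cyclic_flat_sub //.
  by move: cB; rewrite cyclic_flatE => /andP[].
have weightE B : cyclic_flat M B ->
    \sum_(C | cyclic_flat M C && ~~ (B \subset C)) m 'S_ C = t * r B.
  move=> cB; rewrite -(expansion_rank hMt) // -eq_m; last first.
    by apply/(expansion_cyclic_flat hMt); exists B.
  rewrite /flat_weight sum_expansion_cyclic_flats; apply: eq_bigl => C.
  by case cC: (cyclic_flat M C); rewrite //= block_union_sub ?cyclic_flat_sub.
have [n] := ubnP (#|E| - #|A|); elim: n A => // n IHn A ltA cA nA.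
(* Split the equation for [K] by whether [C] contains [A]: those that do not add up to [t * r A],
   and those that do are [A] itself and larger flats, covered by induction. *)
have := weightE K cE; rewrite (bigID (fun C : {set T} => A \subset C)) /= addnC.
rewrite (eq_bigl (fun C : {set T} => cyclic_flat M C && ~~ (A \subset C))); last first.
  move=> C; case cC: (cyclic_flat M C) => //=; case sAC: (A \subset C); rewrite ?andbF //.
  by rewrite andbT; apply: contraFN sAC => /(subset_trans _)->; rewrite ?sK.
rewrite weightE // (bigD1 A) /=; last first.
  rewrite cA subxx andbT /=; apply: contra nA => sKA.
  by rewrite eqEsubset sKA sK.
move=> /eqP; rewrite eq_sym => /eqP eqK.
have : t %| t * r K by apply: dvdn_mulr.
rewrite eqK dvdn_addr ?dvdn_mulr // dvdn_addl //.
apply: dvdn_sum => C /andP[/andP[/andP[cC nKC] sAC] neC]; apply: IHn => //; last first.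
  by apply: contra nKC => /eqP->.
have ltAC : #|A| < #|C| by rewrite proper_card // properEneq eq_sym neC.
rewrite -ltnS (leq_trans _ ltA) // ltnS ltn_sub2l // (leq_trans ltAC) //.
by rewrite subset_leq_card // cyclic_flat_sub.
Qed.

(** Only the largest cyclic flat can fail the divisibility test. It enters no equation, and keeping
    its weight undivided only weakens the inequalities. *)
Lemma presenting_of_expansion m : 0 < t -> presenting Mt m ->
  presenting M (fun A => if t %| m 'S_ A then m 'S_ A %/ t else m 'S_ A).
Proof.
move=> t0 pm; have [eq_m le_m] := pm; set m1 := fun A => _.
have weightE X : X \subset E -> flat_weight Mt m 'S_ X =
    \sum_(B | cyclic_flat M B && ~~ (X \subset B)) m 'S_ B.
  move=> sX; rewrite /flat_weight sum_expansion_cyclic_flats; apply: eq_bigl => B.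
  by case cB: (cyclic_flat M B); rewrite //= block_union_sub // cyclic_flat_sub.
split=> [A cA|X sX]; last first.
  rewrite -(leq_pmul2l t0) -rank_expansion // (leq_trans (le_m _ _)) //.
    by rewrite (expansion_ground hMt) block_unionS.
  rewrite weightE // big_distrr /=; apply: leq_sum => B _.
  by rewrite /m1; case: ifP => [d|_]; [rewrite mulnC divnK | apply: leq_pmull].
have sA := cyclic_flat_sub cA; apply/eqP; rewrite -(eqn_pmul2l t0) -rank_expansion //.
rewrite -eq_m; last by apply/(expansion_cyclic_flat hMt); exists A.
rewrite weightE // big_distrr /=; apply/eqP/eq_bigr => B /andP[cB nAB].
suff dB : t %| m 'S_ B by rewrite /m1 dB mulnC divnK.
apply: dvd_presenting_expansion => //; apply: contraNneq nAB => ->.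
by apply: cyclic_core_max => //; move: cA; rewrite cyclic_flatE => /andP[].
Qed.

Lemma fundamental_basis_expansion B :
  fundamental_basis M B -> fundamental_basis Mt 'S_ B.
Proof.
case=> /basis_rankP[iB cB] hB; have sB := indep_ground iB; split=> [|F].
  apply/basis_rankP; split; first by rewrite indep_expansion block_indep.
  by rewrite (card_block_union blk) // cB (expansion_ground hMt) rank_expansion.
case/(expansion_cyclic_flat hMt)=> A cA ->; have sA := cyclic_flat_sub cA.
rewrite -(block_unionI blk) // (card_block_union blk) ?subIset ?sA //.
by rewrite rank_expansion // hB.
Qed.

(** [Y] may cut through blocks. In [#|Y :&: 'S_ A| <= t * r A] the left side is modular and the
    right side submodular in [A], so equality passes to unions and intersections and makes [r]
    modular there. *)
Lemma fundamental_basis_of_expansion Y : 0 < t ->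
  fundamental_basis Mt Y -> exists B, fundamental_basis M B.
Proof.
move=> t0 [/basis_rankP[iY cY] hY].
pose L A := (A \subset E) && (#|Y :&: 'S_ A| == t * r A).
have leY A : A \subset E -> #|Y :&: 'S_ A| <= t * r A.
  move=> sA; rewrite -rank_expansion // rank_ge ?subsetIr //.
  by apply: indepS iY; rewrite subsetIl.
have LUI A B : L A -> L B -> [/\ L (A :|: B), L (A :&: B) &
    r (A :|: B) + r (A :&: B) = r A + r B].
  case/andP=> sA /eqP tA /andP[sB /eqP tB].
  have sU : A :|: B \subset E by rewrite subUset sA.
  have sI : A :&: B \subset E by rewrite subIset ?sA.
  have := cardsUI (Y :&: 'S_ A) (Y :&: 'S_ B).
  rewrite -setIUr -block_unionU setIACA setIid -(block_unionI blk) // tA tB -mulnDr => eqYUI.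
  have leU := leY _ sU; have leI := leY _ sI; have leR := rank_submod M A B.
  have leR' : t * (r (A :|: B) + r (A :&: B)) <= t * (r A + r B) by rewrite leq_mul2l leR orbT.
  have eU : #|Y :&: 'S_(A :|: B)| = t * r (A :|: B).
    apply/eqP; rewrite eqn_leq leU -(leq_add2r (t * r (A :&: B))) -mulnDr.
    by rewrite (leq_trans leR') // -eqYUI leq_add2l.
  have eI : #|Y :&: 'S_(A :&: B)| = t * r (A :&: B).
    apply/eqP; rewrite eqn_leq leI -(leq_add2l (t * r (A :|: B))) -mulnDr.
    by rewrite (leq_trans leR') // -eqYUI leq_add2r.
  split; rewrite /L ?sU ?sI ?eU ?eI //=.
  by apply/eqP; rewrite -(eqn_pmul2l t0) -eqYUI eU eI mulnDr.
have LE : L E.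
  rewrite /L subxx (setIidPl _); last by rewrite -(expansion_ground hMt) indep_ground.
  by rewrite cY (expansion_ground hMt) rank_expansion /= ?eqxx.
have [||||B [iB sB hB]] := @modular_ring_indep _ M L _ _ _ _ E LE.
- by rewrite /L sub0set /block_union big_set0 setI0 cards0 rank0 muln0.
- by move=> A B LA LB; case: (LUI A B LA LB).
- by move=> A B LA LB; case: (LUI A B LA LB).
- by move=> A B LA LB; case: (LUI A B LA LB).
exists B; split.
  by apply/basis_rankP; split=> //; rewrite -hB // (setIidPl sB).
move=> A cA; have sA := cyclic_flat_sub cA; rewrite setIC hB //.
have cF : cyclic_flat Mt 'S_ A by apply/(expansion_cyclic_flat hMt); exists A.
by rewrite /L sA setIC -hY // rank_expansion //= eqxx.
Qed.

End Transfer.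

(** Treated apart because an empty ground set allows [t = 0]. *)
Lemma fundamental_empty_ground (T : finType) (M : matroid T) :
  ground M = set0 -> fundamental_transversal_matroid M.
Proof.
move=> E0; have iE X : indep M X = (X == set0).
  apply/idP/eqP=> [/indep_ground|->]; last exact: indep0.
  by rewrite E0 subset0 => /eqP.
split.
  apply: (@transversal_of_family _ M void (fun=> set0)) => [//|X]; rewrite iE.
  split=> [/eqP-> Y|/(_ X (subxx _))]; first by rewrite subset0 => /eqP->; rewrite cards0.
  by rewrite -cards_eq0 -leqn0 => /leq_trans; apply; rewrite -(card_void) max_card.
exists set0; first by apply/basis_rankP; rewrite indep0 E0 rank0 cards0.
by move=> F /cyclic_flat_sub; rewrite E0 subset0 => /eqP->; rewrite rank0 set0I cards0.
Qed.

Theorem theorem3p13 (t : nat) (T U : finType) (M : matroid T)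
    (i : T -> U) (S : T -> {set U}) (Mt : matroid U)
    (hMt : is_expansion t M i S Mt) :
  (transversal_matroid M <-> transversal_matroid Mt) /\
  (fundamental_transversal_matroid M <-> fundamental_transversal_matroid Mt).
Proof.
have [E0|[e eE]] := set_0Vmem (ground M).
  have fM := fundamental_empty_ground E0.
  have fMt : fundamental_transversal_matroid Mt.
    apply: fundamental_empty_ground.
    by rewrite (expansion_ground hMt) E0 /block_union big_set0.
  by case: (fM) (fMt) => tM _ [tMt _].
(* The block of [e] contains [i e], so it is not empty. *)
have t0 : 0 < t := t_gt0 (expansion_blocksP hMt) eE.
have tr : transversal_matroid M <-> transversal_matroid Mt.
  split=> /presenting_of_transversal[m pm].
    exact: transversal_of_presenting (presenting_expansion hMt pm).
  exact: transversal_of_presenting (presenting_of_expansion hMt t0 pm).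
split=> //; split=> -[/tr tM [B bB hB]]; split=> //.
  have [bB' hB'] := fundamental_basis_expansion hMt (conj bB hB).
  by exists (block_union S B).
have [B' [bB' hB']] := fundamental_basis_of_expansion hMt t0 (conj bB hB).
by exists B'.
Qed.
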